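(* Let $f$ be a non-increasing demand function and $c$ the unit cost, and assume the profit function $p\mapsto(p-c)f(p)$ is unimodal. Let $p^*$ be the true optimal price, i.e. the maximizer of $(p-c)f(p)$. Let $p_a$ be the algorithmic price, let $j^*$ be the index of a grid price with the highest empirical profit, and let the safeguarded price be $$\hat p=\max\{\min\{p_a,p_{j^*+1}\},p_{j^*-1}\}.$$ The augmentation improves the algorithmic price, i.e. $$(\hat p-c)f(\hat p)\ \ge\ (p_a-c)f(p_a),$$ if $p^*\in[p_{j^*-1},p_{j^*+1}]$. In particular, the condition $p^*\in[p_{j^*-1},p_{j^*+1}]$ always holds when $K\to\infty$, where $K$ is the number of demand observations per grid price.
   Context: Setting: a monopolist with unit cost $c$, nominal price $\bar p$, and unknown demand function $f$. The price grid is $p_j=c+j\frac{\bar p-c}{n}$, $j=0,1,\dots,n$. At each grid price $p_j$ one observes $K$ noisy demands $f(p_j)+\epsilon_{jk}$, $k=1,\dots,K$, with mean $f(p_j)$, where the $\epsilon_{jk}$ are independent $\sigma$-sub-Gaussian noises. The averaged demand estimate is $\tilde f(p_j)=f(p_j)+\frac1K\sum_{k=1}^K\epsilon_{jk}$, and $j^*$ satisfies $(p_{j^*}-c)\tilde f(p_{j^*})\ge(p_j-c)\tilde f(p_j)$ for all $j=0,\dots,n$. The algorithm fits a (possibly misspecified) linear demand $\hat\alpha-\hat\beta p$, with $(\hat\alpha,\hat\beta)$ minimizing $\sum_{j=0}^n\sum_{k=1}^K(f(p_j)+\epsilon_{jk}-\alpha+\beta p_j)^2$ over $(\alpha,\beta)$,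 and outputs $p_a=\arg\max_p(p-c)(\hat\alpha-\hat\beta p)=\frac{\hat\alpha}{2\hat\beta}+\frac c2$.
   Formalization: For the final claim (K→∞) two conditions are added, without which it can fail: p* lies in [c, p̄], and the profit is strictly increasing then strictly decreasing on [c, p̄]; ''always holds'' is read as almost surely for all large K. *)

(* Defs.v *)
From HB Require Import structures.
From mathcomp Require Import all_boot all_order all_algebra.
From mathcomp Require Import all_classical all_reals all_analysis.
From mathcomp Require Import ring lra.

Set Implicit Arguments.
Unset Strict Implicit.
Unset Printing Implicit Defensive.

Import Order.TTheory GRing.Theory Num.Theory.
Import numFieldNormedType.Exports.

Local Open Scope classical_set_scope.
Local Open Scope ring_scope.

Section Pricing.
Context {R : realType}.

Definition profit (c : R) (f : R -> R) (p : R) : R := (p - c) * f p.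

Definition is_maximizer (g : R -> R) (x : R) : Prop := forall y, g y <= g x.

Definition unimodal (g : R -> R) : Prop :=
  exists m, {in `]-oo, m] &, nondecreasing_fun g} /\
            {in `[m, +oo[ &, nonincreasing_fun g}.

(* Without plateaus on [a, b]. *)
Definition strictly_unimodal_on (a b : R) (g : R -> R) : Prop :=
  exists2 m, m \in `[a, b] &
    {in `[a, m] &, {homo g : x y / x < y}} /\
    {in `[m, b] &, {homo g : x y / x < y >-> y < x}}.

(* The index is an integer, not an element of {0, ..., n}, so that the
   neighbours p_(-1) and p_(n+1) of the two extreme grid prices make sense;
   they are given by the same formula. *)
Definition grid_price (c pbar : R) (n : nat) (j : int) : R :=
  c + j%:~R * ((pbar - c) / n%:R).

Definition neighbourhood (c pbar : R) (n : nat) (j : int) : interval R :=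
  `[grid_price c pbar n (j - 1), grid_price c pbar n (j + 1)].

(* In the next five definitions e j k is one realization of the noise of the
   (k+1)-st observation at p_j; a sample of size K uses e j 0, ..., e j (K-1). *)

Definition observed_demand (c pbar : R) (n : nat) (f : R -> R)
    (e : 'I_n.+1 -> nat -> R) (j : 'I_n.+1) (k : nat) : R :=
  f (grid_price c pbar n j) + e j k.

Definition average_demand (c pbar : R) (n : nat) (f : R -> R)
    (e : 'I_n.+1 -> nat -> R) (K : nat) (j : 'I_n.+1) : R :=
  f (grid_price c pbar n j) + K%:R^-1 * \sum_(k < K) e j k.

Definition highest_empirical_profit (c pbar : R) (n : nat) (f : R -> R)
    (e : 'I_n.+1 -> nat -> R) (K : nat) (jstar : 'I_n.+1) : Prop :=
  forall j : 'I_n.+1,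
    (grid_price c pbar n j - c) * average_demand c pbar f e K j <=
    (grid_price c pbar n jstar - c) * average_demand c pbar f e K jstar.

Definition squared_error (c pbar : R) (n : nat) (f : R -> R)
    (e : 'I_n.+1 -> nat -> R) (K : nat) (alpha beta : R) : R :=
  \sum_(j < n.+1) \sum_(k < K)
    (observed_demand c pbar f e j k - alpha
       + beta * grid_price c pbar n j) ^+ 2.

Definition least_squares_fit (c pbar : R) (n : nat) (f : R -> R)
    (e : 'I_n.+1 -> nat -> R) (K : nat) (alpha beta : R) : Prop :=
  forall a b, squared_error c pbar f e K alpha beta <=
              squared_error c pbar f e K a b.

Definition algorithmic_price (c alpha beta : R) : R :=
  alpha / (2 * beta) + c / 2.

Lemma algorithmic_price_unique_maximizer (c alpha beta p : R) : 0 < beta ->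
  is_maximizer (profit c (fun q => alpha - beta * q)) p <->
  p = algorithmic_price c alpha beta.
Proof.
move=> b0; set pa := algorithmic_price c alpha beta.
have E q : profit c (fun r => alpha - beta * r) pa -
           profit c (fun r => alpha - beta * r) q = beta * (q - pa) ^+ 2.
  by rewrite /profit /pa /algorithmic_price; field; rewrite gt_eqF.
split=> [/(_ pa)|-> q]; last first.
  by rewrite -subr_ge0 E mulr_ge0 ?sqr_ge0 ?ltW.
rewrite -subr_le0 E pmulr_rle0// => h; apply/eqP; rewrite -subr_eq0 -sqrf_eq0.
by rewrite eq_le h sqr_ge0.
Qed.

Definition safeguarded_price (c pbar : R) (n : nat) (j : int) (pa : R) : R :=
  Num.max (Num.min pa (grid_price c pbar n (j + 1)))
          (grid_price c pbar n (j - 1)).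

End Pricing.

Section Noise.
Context {R : realType} {d : measure_display} {T : measurableType d}.
Variable P : probability T R.

(* Mutual independence of a possibly infinite family. *)
Definition independent_RVs (I : choiceType) (X : I -> {RV P >-> R}) : Prop :=
  forall (s : seq I) (B : I -> set R), uniq s ->
    (forall i, measurable (B i)) ->
    P (\bigcap_(i in [set` s]) (X i @^-1` B i)) =
    (\prod_(i <- s) P (X i @^-1` B i))%E.

Definition sub_gaussian (sigma : R) (X : {RV P >-> R}) : Prop :=
  forall t : R, ('M_P X t <= (expR (sigma ^+ 2 * t ^+ 2 / 2))%:E)%E.

Definition sub_gaussian_noise (n : nat) (sigma : R)
    (eps : 'I_n.+1 -> nat -> {RV P >-> R}) : Prop :=
  [/\ independent_RVs (fun jk : 'I_n.+1 * nat => eps jk.1 jk.2),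
      forall j k, ('E_P[eps j k] = 0)%E &
      forall j k, sub_gaussian sigma (eps j k)].

End Noise.

(* Main.v *)
Require Import Defs.
From HB Require Import structures.
From mathcomp Require Import all_boot all_order all_algebra.
From mathcomp Require Import all_classical all_reals all_analysis.
From mathcomp Require Import measurable_realfun zify ring lra.

Set Implicit Arguments.
Unset Strict Implicit.
Unset Printing Implicit Defensive.

Import Order.TTheory GRing.Theory Num.Theory.
Import numFieldNormedType.Exports.

Local Open Scope classical_set_scope.
Local Open Scope ring_scope.

(** Unimodality makes profit monotone along any segment towards [pstar], and
    clamping [pa] to an interval containing [pstar] moves it towards [pstar].

    For the limit [K --> oo], the averaged noises vanish almost surely, by a
    strong law of large numbers that only uses pairwise uncorrelatedness and
    bounded variances: with [S] the partial sums, [(S (r ^ 2)) ^+ 2 / r ^+ 4]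
    plus the sum over [r ^ 2 <= K < (r + 1) ^ 2] of
    [(S K - S (r ^ 2)) ^+ 2 / r ^+ 4] has an expectation of order [1 / r ^+ 2],
    which is summable, so it tends to [0] almost surely, and it dominates
    [(S K / K) ^+ 2] up to a factor [2].  The empirical profits on the grid
    then converge to the true ones, and eventually an empirical maximizer is a
    true maximizer on the grid; by strict unimodality a grid price with [pstar]
    beyond one of its neighbours is beaten by that neighbour. *)

(** * Unimodal profits and clamping of a price *)

Section optimality.
Context {R : realType}.
Implicit Types g : R -> R.

(** The mode [m] given by [unimodal] may differ from [u]. If [y] lies between [m] and [u],
    monotonicity on that side of [m] gives [g u <= g y], and [g x <= g u] by maximality; otherwise
    [x] and [y] are on the same side of [m]. *)
Lemma unimodal_ge_min g u x y : unimodal g -> is_maximizer g u ->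
  x <= y <= u \/ u <= y <= x -> g x <= g y.
Proof.
move=> [m [gi gd]] umax; case=> /andP[h1 h2].
- have [ym|/ltW my] := leP y m.
    by apply: gi; rewrite ?in_itv//= (le_trans h1).
  apply: le_trans (umax x) _; apply: gd; rewrite ?in_itv//= ?my//.
  by rewrite (le_trans my).
- have [my|/ltW ym] := leP m y.
    by apply: gd; rewrite ?in_itv/= ?andbT// (le_trans my).
  apply: le_trans (umax x) _; apply: gi; rewrite ?in_itv//=.
  by rewrite (le_trans h1).
Qed.

(** A strict mode distinct from [u] would have a value above the maximum [g u]. *)
Lemma strictly_unimodal_on_mode g a b u : u \in `[a, b] -> is_maximizer g u ->
  strictly_unimodal_on a b g ->
  {in `[a, u] &, {homo g : x y / x < y}} /\
  {in `[u, b] &, {homo g : x y / x < y >-> y < x}}.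
Proof.
move=> uab umax [m mab [gi gd]].
suff -> : u = m by [].
move: uab mab; rewrite !in_itv/= => /andP[au ub] /andP[am mb].
apply/eqP; rewrite eq_le !leNgt; apply/andP; split; apply/negP => h.
- have := umax m; rewrite leNgt gd// in_itv/= ?lexx ?mb//.
  by rewrite (ltW h).
- have := umax m; rewrite leNgt gi// in_itv/= ?lexx ?am//.
  by rewrite au (ltW h).
Qed.

Lemma safeguarded_price_improves (c pbar u p : R) f n (j : int) :
  unimodal (profit c f) -> is_maximizer (profit c f) u ->
  u \in neighbourhood c pbar n j ->
  profit c f p <= profit c f (safeguarded_price c pbar n j p).
Proof.
move=> uni umax; rewrite in_itv/= => /andP[lu uh].
rewrite /safeguarded_price; set l := grid_price _ _ _ (j - 1) in lu *.
set h := grid_price _ _ _ (j + 1) in uh *.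
apply: (unimodal_ge_min uni umax).
have lh : l <= h := le_trans lu uh.
(* Below [l] the price moves up to [l <= u], above [h] it moves down to [h >= u], and in between it
   stays put. *)
have [pl|lp] := leP p l.
  by rewrite min_l ?(le_trans pl)// max_r//; left.
have [ph|/ltW hp] := leP p h.
  rewrite max_l ?(ltW lp)//.
  by have [pu|/ltW up] := leP p u; rewrite lexx; [left|right; rewrite up].
by rewrite max_l//; right; rewrite uh hp.
Qed.

End optimality.

(** * Independent products and second moments of sub-Gaussian variables *)

Section independence.
Context {R : realType} {d : measure_display} {T : measurableType d}.
Variable P : probability T R.
Implicit Types X Y : {RV P >-> R}.

Lemma independent_RVs_pair (I : choiceType) (X : I -> {RV P >-> R}) i j
    (A B : set R) : independent_RVs X -> i != j ->
  measurable A -> measurable B ->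
  (P (X i @^-1` A `&` X j @^-1` B) = P (X i @^-1` A) * P (X j @^-1` B))%E.
Proof.
move=> indep ij mA mB.
have ji : (j == i) = false by rewrite eq_sym (negbTE ij).
have := indep [:: i; j] (fun k => if k == i then A else B).
rewrite /= inE ij => /(_ isT) h.
have {h} := h _.
rewrite !big_cons big_nil eqxx ji mule1 => <-; last by move=> k; case: ifP.
congr (P _); apply/seteqP; split => x /=.
- by move=> [xA xB] k /=; rewrite !inE => /orP[]/eqP->; rewrite ?eqxx ?ji.
- move=> h; split.
  + by have := h i; rewrite /= eqxx; apply; rewrite !inE eqxx.
  + by have := h j; rewrite /= ji; apply; rewrite !inE eqxx orbT.
Qed.

(** The joint law of [(X, Y)] agrees with the product of the two laws on rectangles, hence
    everywhere; Fubini then factors the integral of [z.1 * z.2]. *)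
Lemma expectation_mul_independent X Y :
  (forall A B : set R, measurable A -> measurable B ->
    P (X @^-1` A `&` Y @^-1` B) = P (X @^-1` A) * P (Y @^-1` B))%E ->
  (X : T -> R) \in Lfun P 1 -> (Y : T -> R) \in Lfun P 1 ->
  (X \* Y : T -> R) \in Lfun P 1 ->
  ('E_P[X \* Y] = 'E_P[X] * 'E_P[Y])%E.
Proof.
move=> indep /Lfun1_integrable iX /Lfun1_integrable iY /Lfun1_integrable iXY.
have mZ : measurable_fun setT (fun w => (X w, Y w)).
  by apply: measurable_fun_pair.
pose Z : {mfun T >-> (R * R)%type} := mfun_Sub (mem_set mZ).
pose g (z : R * R) : \bar R := (z.1 * z.2)%:E.
have mg : measurable_fun setT g.
  apply/measurable_EFinP; apply: measurable_funM.
    exact: measurable_fst.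
  exact: measurable_snd.
have prodE A : measurable A ->
    (distribution P X \x distribution P Y)%E A = distribution P Z A.
  move=> mA; apply: product_measure_unique mA => B C mB mC.
  exact: indep.
have iZ : (distribution P Z).-integrable setT g.
  exact: integrable_pushforward.
have ig : (distribution P X \x distribution P Y)%E.-integrable setT g.
  case/integrableP: iZ => _ iZ; apply/integrableP; split => //.
  rewrite (eq_measure_integral (distribution P Z))// => A mA _.
  exact: prodE.
transitivity (\int[distribution P Z]_z g z)%E.
  by rewrite integral_distribution// unlock.
transitivity (\int[(distribution P X \x distribution P Y)%E]_z g z)%E.
  by apply/esym/eq_measure_integral => A mA _; exact: prodE.
rewrite -integral12_prod_meas1//.
have EX : (\int[distribution P X]_x x%:E = 'E_P[X])%E.
  by rewrite (@integral_distribution _ _ _ _ _ P X EFin)// unlock.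
have EY : (\int[distribution P Y]_x x%:E = 'E_P[Y])%E.
  by rewrite (@integral_distribution _ _ _ _ _ P Y EFin)// unlock.
have iXd : (distribution P X).-integrable setT EFin.
  exact: integrable_pushforward.
have iYd : (distribution P Y).-integrable setT EFin.
  exact: integrable_pushforward.
have finY : ('E_P[Y] \is a fin_num)%E by rewrite -EY integrable_fin_num.
rewrite -EX -(fineK finY) -integralZr//; apply: eq_integral => x _.
by rewrite /fubini_F /g/= fineK// -EY -integralZl.
Qed.

Lemma Lfun2_sqr_integrable (X : T -> R) : measurable_fun setT X ->
  (\int[P]_w ((X w) ^+ 2)%:E < +oo)%E -> X \in Lfun P 2%:E.
Proof.
move=> mX Xoo; rewrite inE; apply/andP; split; rewrite inE//=.
rewrite /finite_norm unlock poweR_lty//; apply: le_lt_trans Xoo.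
rewrite le_eqVlt; apply/orP; left; apply/eqP/eq_integral => w _.
by rewrite /= powR_mulrn// real_normK ?num_real.
Qed.

Lemma sqr_le_expRD (x : R) : x ^+ 2 <= 2 * (expR x + expR (- x)).
Proof.
have key (y : R) : 0 <= y -> y ^+ 2 <= 2 * expR y.
  (* The quadratic term of the exponential series: [1 + y ^+ 2 / 2 <= expR y]. *)
  by move=> /(expR_ge1Dxn 1); rewrite -[(2`!)%N]/2%N; lra.
have [x0|/ltW x0] := leP 0 x.
  by have := key _ x0; have := expR_ge0 (- x); lra.
have := key (- x); rewrite oppr_ge0 sqrrN => /(_ x0).
by have := expR_ge0 x; lra.
Qed.

(** The moment generating function at [1] and [-1] controls both exponentials in [sqr_le_expRD]. The
    bound is crude, but uniform over the noise variables. *)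
Lemma sub_gaussian_sqr (sigma : R) X : sub_gaussian sigma X ->
  (\int[P]_w ((X w) ^+ 2)%:E <= (4 * expR (sigma ^+ 2 / 2))%:E)%E.
Proof.
move=> sg; have := sg 1; have := sg (-1).
rewrite /mmt_gen_fun sqrrN expr1n mulr1 unlock => sgN sgP.
apply: (@le_trans _ _ (\int[P]_w (2 * (expR (X w) + expR (- X w)))%:E)%E).
  apply: ge0_le_integral => //.
  - by move=> w _; rewrite lee_fin sqr_ge0.
  - by apply/measurable_EFinP; exact: measurable_funX.
  - apply/measurable_EFinP; apply: measurable_funM => //.
    apply: measurable_funD; apply: measurableT_comp => //.
    exact: measurableT_comp.
  - by move=> w _; rewrite lee_fin sqr_le_expRD.
under eq_integral do rewrite EFinM (EFinD (expR _)).
have mE : measurable_fun setT (fun w => (expR (X w))%:E).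
  by apply/measurable_EFinP; exact: measurableT_comp.
have mEN : measurable_fun setT (fun w => (expR (- X w))%:E).
  apply/measurable_EFinP; apply: measurableT_comp => //.
  exact: measurableT_comp.
rewrite ge0_integralZl//; last 2 first.
- exact: emeasurable_funD.
- by move=> w _; rewrite adde_ge0// lee_fin expR_ge0.
rewrite ge0_integralD//; try by move=> w _; rewrite lee_fin expR_ge0.
have -> : 4 * expR (sigma ^+ 2 / 2) =
    2 * (expR (sigma ^+ 2 / 2) + expR (sigma ^+ 2 / 2)) by ring.
rewrite EFinM (EFinD (expR _)) lee_wpmul2l ?lee_fin//; apply: leeD.
- by under eq_integral do rewrite -[X _]mulr1.
- by under eq_integral do rewrite -[X _]mulr1 -mulrN.
Qed.

End independence.

(** * Averages between consecutive squares, for a fixed sequence *)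

Section block_energy.
Context {R : realType}.
Implicit Types x : nat -> R.

(** The shift [r = m + 1] keeps the denominator nonzero. The block from [r ^ 2] to [(r + 1) ^ 2 - 1]
    has [2 r + 1] members; summing the squared increments, instead of taking their maximum, lets
    expectations be computed termwise. *)
Definition block_energy x (m : nat) : R :=
  ((\sum_(k < m.+1 ^ 2) x k) ^+ 2 +
   \sum_(i < (2 * m.+1).+1) (\sum_(k < i) x (m.+1 ^ 2 + k)%N) ^+ 2) /
  m.+1%:R ^+ 4.

Lemma block_energy_ge0 x m : 0 <= block_energy x m.
Proof.
rewrite divr_ge0 ?exprn_ge0// addr_ge0 ?sqr_ge0// sumr_ge0// => i _.
exact: sqr_ge0.
Qed.

Lemma square_interval (K : nat) : exists r, (r ^ 2 <= K < r.+1 ^ 2)%N.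
Proof.
elim: K => [|K [r /andP[rK Kr]]]; first by exists 0%N.
have [Kr'|Kr'] := ltnP K.+1 (r.+1 ^ 2); first by exists r; rewrite Kr' leqW.
by exists r.+1; rewrite Kr' (leq_ltn_trans Kr)// ltn_exp2r.
Qed.

(** Split the sum at [r ^ 2] into [a + b] and use [(a + b) ^+ 2 <= 2 (a ^+ 2 + b ^+ 2)]; [b ^+ 2] is
    one summand of the energy, and [K ^ 2 >= r ^ 4]. *)
Lemma sqr_mean_le_block_energy x m K : (m.+1 ^ 2 <= K < m.+2 ^ 2)%N ->
  (K%:R^-1 * \sum_(k < K) x k) ^+ 2 <= 2 * block_energy x m.
Proof.
move=> /andP[rK Kr]; set r := m.+1 in rK Kr *.
have [i ir Ki] : exists2 i, (i < (2 * r).+1)%N & K = (r ^ 2 + i)%N.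
  by exists (K - r ^ 2)%N; lia.
have sE : \sum_(k < K) x k =
    \sum_(k < r ^ 2) x k + \sum_(k < i) x (r ^ 2 + k)%N.
  by rewrite Ki big_split_ord.
rewrite sE; set a := \sum_(k < r ^ 2) _; set b := \sum_(k < i) _.
have bE : b ^+ 2 <= \sum_(j < (2 * r).+1) (\sum_(k < j) x (r ^ 2 + k)%N) ^+ 2.
  by rewrite (bigD1 (Ordinal ir))//= lerDl sumr_ge0// => j _; exact: sqr_ge0.
rewrite exprMn mulrC /block_energy -/r -/a mulrA.
apply: ler_pM; rewrite ?sqr_ge0//.
- have := sqr_ge0 (a - b); move: bE; set c := \sum_(j < _) _; nra.
- rewrite exprVn lef_pV2 ?posrE ?exprn_gt0//; last by rewrite ltr0n; lia.
  by rewrite -!natrX ler_nat (_ : (r ^ 4 = (r ^ 2) ^ 2)%N) ?leq_exp2r// -expnM.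
Qed.

Lemma mean_cvg0 x : block_energy x @ \oo --> 0 ->
  (K%:R^-1 * \sum_(k < K) x k) @[K --> \oo] --> 0.
Proof.
move=> /cvgr0Pnorm_lt xE; apply/cvgr0Pnorm_lt => e e0.
(* Halving absorbs the factor [2] of [sqr_mean_le_block_energy]. *)
have /xE[M _ ME] : 0 < e ^+ 2 / 2 by rewrite divr_gt0// exprn_gt0.
exists (M.+1 ^ 2)%N => // K /= MK.
have [[|m] rK] := square_interval K; first by move: rK MK; lia.
have Mm : (M <= m)%N by move: rK MK; rewrite !expnS !expn0; nia.
have := ME m Mm; rewrite ger0_norm ?block_energy_ge0// => h.
rewrite -(ltr_pXn2r (ltn0Sn 1)) ?nnegrE ?(ltW e0)// real_normK ?num_real//.
apply: le_lt_trans (sqr_mean_le_block_energy _ rK) _.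
by move: h; rewrite ltr_pdivlMr// mulrC.
Qed.

End block_energy.

(** * Strong law for uncorrelated variables of bounded variance *)

Section strong_law.
Context {R : realType} {d : measure_display} {T : measurableType d}.
Variable P : probability T R.

Lemma nneseries_fin_cvg0 (u : nat -> R) : (forall m, 0 <= u m) ->
  (\sum_(m <oo) (u m)%:E < +oo)%E -> u @ \oo --> 0.
Proof.
move=> u0 uoo.
have u0' m : (0 <= (u m)%:E)%E by rewrite lee_fin.
have s0 : (0 <= \sum_(m <oo) (u m)%:E)%E by apply: nneseries_ge0.
apply: cvg_series_cvg_0; apply: nondecreasing_is_cvgn.
  by apply/nondecreasing_seqP => n; rewrite seriesSr lerDl.
exists (fine (\sum_(m <oo) (u m)%:E)%E) => _ [n _ <-].
rewrite -lee_fin fineK ?ge0_fin_numE// /series/= -sumEFin.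
exact: nneseries_lim_ge.
Qed.

(** Exchanging sum and integral, the series of the [W m] has expectation at most [C]; it is thus
    finite almost surely, and its terms vanish. *)
Lemma ae_cvg0_of_summable_integral (W : nat -> T -> R) (u : nat -> R) (C : R) :
  (forall m, measurable_fun setT (W m)) -> (forall m w, 0 <= W m w) ->
  (forall m, \int[P]_w (W m w)%:E <= (u m)%:E)%E ->
  (forall n, \sum_(m < n) u m <= C) ->
  {ae P, forall w, W ^~ w @ \oo --> 0}.
Proof.
move=> mW W0 Wu uC.
have W0' m w : (0 <= (W m w)%:E)%E by rewrite lee_fin.
have mW' m : measurable_fun setT (EFin \o W m) by exact/measurable_EFinP.
have mS : measurable_fun setT (fun w => \sum_(m <oo) (W m w)%:E)%E.
  apply: ge0_emeasurable_sum => [m w _ _|m _]; [exact: W0'|exact: mW'].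
have S0 w : (0 <= \sum_(m <oo) (W m w)%:E)%E by apply: nneseries_ge0.
have Soo : P.-integrable setT (fun w => \sum_(m <oo) (W m w)%:E)%E.
  apply/integrableP; split => //.
  under eq_integral do rewrite gee0_abs//.
  rewrite integral_nneseries//.
  apply: (@le_lt_trans _ _ C%:E); last exact: ltry.
  apply: lime_le.
    by apply: is_cvg_nneseries => m _ _; apply: integral_ge0.
  apply: nearW => n; rewrite big_mkord.
  apply: (@le_trans _ _ (\sum_(m < n) (u m)%:E)%E); first exact: lee_sum.
  by rewrite sumEFin lee_fin.
apply: filterS (integrable_ae measurableT Soo) => w /(_ I) wfin.
by apply: nneseries_fin_cvg0 => //; rewrite -ge0_fin_numE.
Qed.

Section uncorrelated.
Variables (X : nat -> T -> R) (v : R).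
Hypothesis X2 : forall k, X k \in Lfun P 2%:E.
Hypothesis EX : forall k, ('E_P[X k] = 0)%E.
Hypothesis VX : forall k, ('V_P[X k] <= v%:E)%E.
Hypothesis covX : forall i j, i != j -> covariance P (X i) (X j) = 0%E.

(** A free starting index covers both the partial sums, [a = 0], and the increments inside a block,
    [a = r ^ 2]. *)
Let S a n : T -> R := \sum_(k < n) X (a + k)%N.

Let S_recr a n : S a n.+1 = S a n \+ X (a + n)%N.
Proof. by rewrite /S big_ord_recr. Qed.

Let S2 a n : S a n \in Lfun P 2%:E.
Proof.
elim: n => [|n IH]; first by rewrite /S big_ord0 (_ : 0 = cst 0)// Lfun_cst.
by rewrite S_recr rpredD ?lee1n.
Qed.

Let Pfin : P setT \is a fin_num := fin_num_measure P _ measurableT.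

Let covS a n j : (a + n <= j)%N -> covariance P (S a n) (X j) = 0%E.
Proof.
elim: n => [_|n IH h].
  by rewrite /S big_ord0 (_ : 0 = cst 0)// covariance_cst_l.
rewrite S_recr covarianceDl//= IH ?covX ?adde0//.
  by rewrite neq_ltn -addnS h.
by rewrite (leq_trans _ h)// leq_add2l.
Qed.

Let ES a n : ('E_P[S a n] = 0)%E.
Proof.
elim: n => [|n IH].
  by rewrite /S big_ord0 (_ : 0 = cst 0)// expectation_cst.
by rewrite S_recr expectationD ?IH ?EX ?adde0// Lfun_subset12.
Qed.

(** By [covS] each new variable has no cross term with the sum so far and adds at most [v]. *)
Let VS a n : ('V_P[S a n] <= (n%:R * v)%:E)%E.
Proof.
elim: n => [|n IH].
  by rewrite /S big_ord0 (_ : 0 = cst 0)// variance_cst mul0r.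
rewrite S_recr varianceD// covS// mule0 adde0 -addn1 natrD mulrDl mul1r EFinD.
exact: leeD.
Qed.

Lemma sqr_sum_uncorrelated a n :
  (\int[P]_w ((\sum_(k < n) X (a + k)%N w) ^+ 2)%:E <= (n%:R * v)%:E)%E.
Proof.
have := VS a n; rewrite varianceE// ES expe2 mule0 sube0 unlock.
by under eq_integral do rewrite exprfctE /S fct_sumE.
Qed.

Let mX k : measurable_fun setT (X k).
Proof. by have := sub_Lfun_mfun (X2 k); rewrite inE. Qed.

Let mS a n : measurable_fun setT (fun w => (\sum_(k < n) X (a + k)%N w) ^+ 2).
Proof. by apply: measurable_funX; exact: measurable_sum. Qed.

Let v0 : 0 <= v.
Proof. by rewrite -lee_fin (le_trans _ (VX 0%N))// variance_ge0. Qed.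

Lemma measurable_block_energy m :
  measurable_fun setT (fun w => block_energy (X ^~ w) m).
Proof.
apply: measurable_funM => //; apply: measurable_funD; first exact: (mS 0).
by apply: measurable_sum => i; exact: mS.
Qed.

(* With [r = m + 1], the bound is [10 v / r ^+ 2], made telescoping. *)
Lemma integral_block_energy m :
  (\int[P]_w (block_energy (X ^~ w) m)%:E <=
   (20 * v * (m.+1%:R^-1 - m.+2%:R^-1))%:E)%E.
Proof.
set r : R := m.+1%:R.
have r1 : 1 <= r by rewrite ler1n.
have sqr0 a n w : (0 <= ((\sum_(k < n) X (a + k)%N w) ^+ 2)%:E)%E.
  by rewrite lee_fin sqr_ge0.
have mS' a n : measurable_fun setT
    (fun w => ((\sum_(k < n) X (a + k)%N w) ^+ 2)%:E).
  exact/measurable_EFinP.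
under eq_integral do rewrite /block_energy mulrC EFinM EFinD -sumEFin.
rewrite ge0_integralZl//; last 2 first.
- by apply: emeasurable_funD; [exact: (mS' 0%N)|exact: emeasurable_sum].
- by move=> w _; rewrite adde_ge0 ?(sqr0 0%N)// sume_ge0.
rewrite ge0_integralD//; last 4 first.
- by move=> w _; exact: (sqr0 0%N).
- exact: (mS' 0%N).
- by move=> w _; rewrite sume_ge0.
- exact: emeasurable_sum.
rewrite ge0_integral_sum//.
(* An increment inside the block has at most [2 r + 1] terms, hence second moment at most
   [(2 r + 1) v]. *)
apply: (@le_trans _ _ ((r ^+ 4)^-1%:E *
   ((r ^+ 2 * v)%:E + \sum_(i < (2 * m.+1).+1) ((2 * r + 1) * v)%:E))%E).
  rewrite lee_wpmul2l ?lee_fin ?invr_ge0 ?exprn_ge0//; apply: leeD.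
    by apply: le_trans (sqr_sum_uncorrelated 0%N _) _; rewrite natrX.
  apply: lee_sum => i _; apply: le_trans (sqr_sum_uncorrelated _ _) _.
  rewrite lee_fin ler_wpM2r// /r -natrM natr1 ler_nat.
  by rewrite ltnW.
rewrite sumEFin sumr_const card_ord -EFinD -EFinM lee_fin.
rewrite -(mulr_natr (_ * v)) -[(2 * m.+1).+1]addn1 natrD natrM -/r.
rewrite -[m.+2]addn1 natrD -/r.
have -> : 20 * v * (r^-1 - (r + 1%:R)^-1) = v * (20 / (r * (r + 1))).
  by field; rewrite !gt_eqF//; lra.
have -> : (r ^+ 4)^-1 * (r ^+ 2 * v + (2%:R * r + 1) * v * (2%:R * r + 1%:R)) =
   v * ((r ^+ 2 + (2 * r + 1) ^+ 2) / r ^+ 4) by field; lra.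
(* For [r >= 1], [r ^+ 2 + (2 r + 1) ^+ 2 <= 10 r ^+ 2] and [r + 1 <= 2 r], whence the constant
   [20]. *)
rewrite ler_wpM2l// ler_pdivrMr ?exprn_gt0//.
rewrite (_ : _ * r ^+ 4 = 20 * r ^+ 3 / (r + 1)); last first.
  by field; rewrite gt_eqF//; lra.
by rewrite ler_pdivlMr; [nra|lra].
Qed.

Lemma strong_law_uncorrelated : {ae P, forall w,
  (K%:R^-1 * \sum_(k < K) X k w) @[K --> \oo] --> (0:R)}.
Proof.
have := ae_cvg0_of_summable_integral (W := fun m w => block_energy (X ^~ w) m)
  (C := 20 * v) measurable_block_energy (fun m w => block_energy_ge0 _ _)
  integral_block_energy.
have tele n : \sum_(m < n) 20 * v * (m.+1%:R^-1 - m.+2%:R^-1) <= 20 * v.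
  rewrite -mulr_sumr -[leRHS]mulr1 ler_wpM2l ?mulr_ge0//.
  have -> : \sum_(m < n) (m.+1%:R^-1 - m.+2%:R^-1) = 1 - n.+1%:R^-1 :> R.
    elim: n => [|n IH]; first by rewrite big_ord0 invr1 subrr.
    by rewrite big_ord_recr/= IH addrA subrK.
  by rewrite gerBl invr_ge0.
by move=> /(_ tele); apply: filterS => w; exact: mean_cvg0.
Qed.

End uncorrelated.

End strong_law.

(** * Almost sure vanishing of the averaged noise *)

Section noise_mean.
Context {R : realType} {d : measure_display} {T : measurableType d}.
Variable P : probability T R.

Lemma sub_gaussian_noise_mean_cvg0 (n : nat) (sigma : R)
    (eps : 'I_n.+1 -> nat -> {RV P >-> R}) :
  sub_gaussian_noise sigma eps ->
  {ae P, forall w, forall j,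
    (K%:R^-1 * \sum_(k < K) eps j k w) @[K --> \oo] --> (0:R)}.
Proof.
move=> [indep mean0 sg].
(* There are finitely many grid prices, so one almost sure event serves them all. *)
apply: filter_forall => j.
have e2 k : (eps j k : T -> R) \in Lfun P 2%:E.
  apply: Lfun2_sqr_integrable => //.
  exact: le_lt_trans (sub_gaussian_sqr (sg j k)) (ltry _).
have e1 k : (eps j k : T -> R) \in Lfun P 1.
  by rewrite Lfun_subset12// fin_num_measure.
apply: (@strong_law_uncorrelated _ _ _ P (fun k => eps j k : T -> R)
  (4 * expR (sigma ^+ 2 / 2))) => //.
- move=> k; rewrite varianceE// mean0 expe2 mule0 sube0 unlock.
  exact: sub_gaussian_sqr.
- move=> i k ik; rewrite covarianceE ?Lfun2_mul_Lfun1//.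
  rewrite expectation_mul_independent ?Lfun2_mul_Lfun1//.
    by rewrite mean0 mul0e sube0.
  move=> A B mA mB.
  apply: (independent_RVs_pair (i := (j, i)) (j := (j, k)) indep) => //.
  by rewrite xpair_eqE eqxx.
Qed.

End noise_mean.

(** * Grid prices and empirical maximizers *)

Section grid.
Context {R : realType}.
Variables (c pbar : R) (n : nat).
Hypotheses (n0 : (0 < n)%N) (cp : c < pbar).
Local Notation p := (grid_price c pbar n).

Let n0R : 0 < n%:R :> R. Proof. by rewrite ltr0n. Qed.

Lemma ltr_grid_price (i j : int) : (p i < p j) = (i < j).
Proof. by rewrite ltrD2l ltr_pM2r ?divr_gt0 ?subr_gt0// ltr_int. Qed.

Lemma ler_grid_price (i j : int) : (p i <= p j) = (i <= j).
Proof. by rewrite lerD2l ler_pM2r ?divr_gt0 ?subr_gt0// ler_int. Qed.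

Lemma grid_price0 : p 0 = c.
Proof. by rewrite /grid_price mul0r addr0. Qed.

Lemma grid_pricen : p n = pbar.
Proof. by rewrite /grid_price pmulrn; field; rewrite gt_eqF. Qed.

Lemma best_grid_price_neighbourhood (g : R -> R) (u : R) (j : 'I_n.+1) :
  u \in `[c, pbar] -> is_maximizer g u -> strictly_unimodal_on c pbar g ->
  (forall i : 'I_n.+1, g (p i) <= g (p j)) -> u \in neighbourhood c pbar n j.
Proof.
move=> ucp umax /(strictly_unimodal_on_mode ucp umax)[gi gd] jmax.
move: ucp; rewrite !in_itv/= => /andP[cu up].
have j0 : c <= p j by rewrite -[leLHS]grid_price0 ler_grid_price.
have jn : p j <= pbar.
  by rewrite -[leRHS]grid_pricen ler_grid_price lez_nat -ltnS.
apply/andP; split; rewrite leNgt; apply/negP => h.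
(* From [p 0 = c <= u < p (j - 1)], the left neighbour is a genuine grid price; it lies on the
   decreasing side of [u], as does [p j]. *)
- have jgt0 : (0 < j)%N.
    have := le_lt_trans cu h; rewrite -[ltLHS]grid_price0 ltr_grid_price; lia.
  have j1 : (j.-1 < n.+1)%N by rewrite (leq_ltn_trans (leq_pred _)).
  have := jmax (Ordinal j1); rewrite leNgt; apply/negP/negPn.
  have E : j%:Z - 1 = j.-1%:Z by lia.
  rewrite E in h.
  apply: gd; rewrite ?in_itv/= ?jn ?andbT ?(ltW h)//=.
  + by rewrite (le_trans _ jn)// ler_grid_price; lia.
  + by rewrite (le_trans (ltW h))// ler_grid_price; lia.
  + by rewrite ltr_grid_price; lia.
(* Symmetrically, [p (j + 1) < u <= pbar = p n] keeps the right neighbour on the grid. *)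
- have jn1 : (j.+1 < n.+1)%N.
    have := lt_le_trans h up; rewrite -[ltRHS]grid_pricen ltr_grid_price; lia.
  have := jmax (Ordinal jn1); rewrite leNgt; apply/negP/negPn.
  have E : j%:Z + 1 = j.+1%:Z by lia.
  rewrite E in h.
  apply: gi; rewrite ?in_itv/= ?j0 ?(ltW h) ?andbT//=.
  + by rewrite (le_trans _ (ltW h))// ler_grid_price; lia.
  + by rewrite (le_trans j0)// ler_grid_price; lia.
  + by rewrite ltr_grid_price; lia.
Qed.

Lemma highest_empirical_profit_near (f : R -> R) (e : 'I_n.+1 -> nat -> R) :
  (forall j, (K%:R^-1 * \sum_(k < K) e j k) @[K --> \oo] --> (0:R)) ->
  \forall K \near \oo, forall j : 'I_n.+1,
    highest_empirical_profit c pbar f e K j ->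
    forall i : 'I_n.+1, profit c f (p i) <= profit c f (p j).
Proof.
move=> e0.
have emp (j : 'I_n.+1) : (p j - c) * average_demand c pbar f e K j @[K --> \oo]
    --> profit c f (p j).
  apply: cvgM; first exact: cvg_cst.
  by rewrite -[X in _ --> X]addr0; apply: cvgD; [exact: cvg_cst|exact: e0].
apply: filter_forall => j.
suff : \forall K \near \oo, forall i : 'I_n.+1,
    highest_empirical_profit c pbar f e K j ->
    profit c f (p i) <= profit c f (p j).
  by apply: filterS => K h ? i; exact: h.
apply: filter_forall => i.
(* If [p i] is truly better than [p j], the gap of their empirical profits has a positive limit, so
   [j] eventually loses to [i]. *)
have [ij|ji] := leP (profit c f (p i)) (profit c f (p j)); first exact: nearW.
have : \forall K \near \oo, 0 < (p i - c) * average_demand c pbar f e K i -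
    (p j - c) * average_demand c pbar f e K j.
  by apply: (cvgr_gt _ (cvgB (emp i) (emp j))); rewrite subr_gt0.
by apply: filterS => K; rewrite subr_gt0 => + /(_ i); rewrite leNgt => ->.
Qed.

End grid.

Theorem theorem2 (R : realType) (d : measure_display) (T : measurableType d)
    (P : probability T R) (n : nat) (c pbar pstar sigma : R) (f : R -> R)
    (eps : 'I_n.+1 -> nat -> {RV P >-> R})
    (n_gt0 : (0 < n)%N) (c_lt_pbar : c < pbar) (sigma_ge0 : 0 <= sigma)
    (f_nonincreasing : nonincreasing_fun f)
    (profit_unimodal : unimodal (profit c f))
    (pstar_optimal : is_maximizer (profit c f) pstar)
    (noise : sub_gaussian_noise sigma eps) :
  (forall (K : nat) (omega : T) (jstar : 'I_n.+1) (alpha beta : R),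
      (0 < K)%N ->
      highest_empirical_profit c pbar f (fun j k => eps j k omega) K jstar ->
      least_squares_fit c pbar f (fun j k => eps j k omega) K alpha beta ->
      pstar \in neighbourhood c pbar n jstar ->
      let pa := algorithmic_price c alpha beta in
      let phat := safeguarded_price c pbar n jstar pa in
      profit c f phat >= profit c f pa)
  /\
  (pstar \in `[c, pbar] ->
    strictly_unimodal_on c pbar (profit c f) ->
    {ae P, forall omega, \forall K \near \oo, forall jstar : 'I_n.+1,
      highest_empirical_profit c pbar f (fun j k => eps j k omega) K jstar ->
      pstar \in neighbourhood c pbar n jstar}).
Proof.
split=> [K w j alpha beta _ _ _ pstarj|pstarcp strict].
  exact: safeguarded_price_improves.
(* The argument is pathwise from here on: the threshold on [K] depends on [w]. *)
have := sub_gaussian_noise_mean_cvg0 noise; apply: filterS => w.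
move=> meps; apply: filterS (highest_empirical_profit_near c pbar f
  (e := fun j k => eps j k w) meps) => K best j.
by move=> /best; exact: best_grid_price_neighbourhood.
Qed.
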